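(* Let $n,d$ be integers with $1<d<n-1$. If $\{\varphi_j\}_{j=1}^{n}$ is a full spark equiangular tight frame (ETF) for $\mathbb{R}^d$, then $n=2d$.
   Context: A finite sequence $\{\varphi_j\}_{j=1}^n$ of nonzero vectors in $\mathbb{R}^d$ is an ETF for $\mathbb{R}^d$ if $\|\varphi_j\|$ is constant over $j$, $|\langle\varphi_j,\varphi_{j'}\rangle|$ is constant over all $j\neq j'$, and there is $a>0$ such that $\sum_{j=1}^n\langle\varphi_j,y\rangle\varphi_j=ay$ for all $y\in\mathbb{R}^d$. It is full spark if every $d$-vector subset $\{\varphi_j\}_{j\in\mathcal{K}}$, $\#\mathcal{K}=d$, forms a basis for $\mathbb{R}^d$. *)

(* Defs.v *)
From mathcomp Require Import all_boot all_order all_algebra.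
From mathcomp Require Import reals.
Set Implicit Arguments.
Unset Strict Implicit.
Unset Printing Implicit Defensive.
Import Order.TTheory GRing.Theory Num.Theory.
Local Open Scope ring_scope.

Definition dot (R : realType) (d : nat) (u v : 'rV[R]_d) : R :=
  \sum_(i < d) u 0 i * v 0 i.

(* The Euclidean norm; MathComp-Analysis' norm on matrices is the sup norm. *)
Definition enorm (R : realType) (d : nat) (u : 'rV[R]_d) : R :=
  Num.sqrt (dot u u).

Definition equal_norm (R : realType) (d n : nat) (phi : 'I_n -> 'rV[R]_d) :=
  exists r : R, forall j, enorm (phi j) = r.

Definition equiangular (R : realType) (d n : nat) (phi : 'I_n -> 'rV[R]_d) :=
  exists c : R, forall j j', j != j' -> `|dot (phi j) (phi j')| = c.

Definition tight_frame (R : realType) (d n : nat) (phi : 'I_n -> 'rV[R]_d) :=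
  exists2 a : R, 0 < a &
    forall y : 'rV[R]_d, \sum_(j < n) dot (phi j) y *: phi j = a *: y.

Definition ETF (R : realType) (d n : nat) (phi : 'I_n -> 'rV[R]_d) :=
  [/\ forall j, phi j != 0, equal_norm phi, equiangular phi & tight_frame phi].

(* [seq phi j | j in K] keeps repeated vectors, so if phi j = phi j' for two
   distinct indices of K then the family indexed by K is not a basis. *)
Definition full_spark (R : realType) (d n : nat) (phi : 'I_n -> 'rV[R]_d) :=
  forall K : {set 'I_n}, #|K| = d ->
    basis_of {: 'rV[R]_d} [seq phi j | j in K].

(* Main.v *)
Require Import Defs.
From mathcomp Require Import all_boot all_order all_algebra.
From mathcomp Require Import reals ring.
Import Order.TTheory GRing.Theory Num.Theory.
Local Open Scope ring_scope.

(** Write [g] for the common squared norm, [c] for the common modulus of the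
    off-diagonal inner products and [a] for the frame constant. Fix two indices
    [i <> j] with [<phi i, phi j> = s c], where [s = 1] or [s = -1]. Every other
    [k] satisfies [<phi k, phi i> = s <phi k, phi j>] or the same with the
    opposite sign; let [Z] be the set of those of the first kind. Its size is
    pinned down by full spark from both sides.

    - The nonzero vector [phi i - s phi j] is orthogonal to [phi k] for each [k]
      in [Z], and [d] of the vectors span, so [Z] has at most [d - 1] elements
      ([card_agree_lt]).
    - Expanding [phi i + s phi j] in the frame gives a linear relation between
      the [phi k] whose coefficients vanish outside [Z] and [{i, j}]. It is
      nontrivial, because [g + c <> a] when [1 < d < n - 1]. Any [d] of the
      vectors are independent, so [Z] has at least [d - 1] elements
      ([card_agree_ge]).

    The size of [Z] is also determined by the parameters: pairing the frame
    expansion of [phi i] with [phi j] gives [a - 2 g = c (2 #|Z| - (n - 2))]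
    ([card_agree]). With [#|Z| = d - 1] and the trace identity [a d = n g] this
    becomes [(n - 2 d) (g + c d) = 0], whose second factor is positive. *)

Set Implicit Arguments.
Unset Strict Implicit.

(** * The dot product *)

Lemma dotC (R : realType) (d : nat) (u v : 'rV[R]_d) : dot u v = dot v u.
Proof. by apply: eq_bigr => i _; rewrite mulrC. Qed.

Lemma dotDr (R : realType) (d : nat) (u v w : 'rV[R]_d) :
  dot u (v + w) = dot u v + dot u w.
Proof. by rewrite -big_split; apply: eq_bigr => i _; rewrite mxE mulrDr. Qed.

Lemma dotZr (R : realType) (d : nat) (c : R) (u v : 'rV[R]_d) :
  dot u (c *: v) = c * dot u v.
Proof. by rewrite mulr_sumr; apply: eq_bigr => i _; rewrite mxE mulrCA. Qed.

Lemma dot0r (R : realType) (d : nat) (u : 'rV[R]_d) : dot u 0 = 0.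
Proof. by rewrite -(scale0r 0) dotZr mul0r. Qed.

Lemma dot_sumr (R : realType) (d : nat) (I : Type) (r : seq I) (P : pred I)
    (u : 'rV[R]_d) (F : I -> 'rV[R]_d) :
  dot u (\sum_(k <- r | P k) F k) = \sum_(k <- r | P k) dot u (F k).
Proof.
elim/big_rec2: _ => [|k x y _ <-]; first exact: dot0r.
by rewrite dotDr.
Qed.

Lemma dot_ge0 (R : realType) (d : nat) (u : 'rV[R]_d) : 0 <= dot u u.
Proof. by apply: sumr_ge0 => i _; rewrite -expr2 sqr_ge0. Qed.

Lemma dot_eq0 (R : realType) (d : nat) (u : 'rV[R]_d) : dot u u = 0 -> u = 0.
Proof.
move=> u0; apply/rowP => i; rewrite mxE; apply/eqP; rewrite -sqrf_eq0 expr2.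
have /psumr_eq0P uP : forall k : 'I_d, true -> 0 <= u 0 k * u 0 k.
  by move=> k _; rewrite -expr2 sqr_ge0.
by rewrite (uP u0).
Qed.

(** * Consequences of full spark *)

(** Since [d] of the vectors indexed by [Z] span the space, [u] is orthogonal to
    itself. *)
Lemma full_spark_orthogonal_eq0 (R : realType) (n d : nat)
    (phi : 'I_n -> 'rV[R]_d) (Z : {set 'I_n}) (u : 'rV[R]_d) :
  full_spark phi -> (d <= #|Z|)%N -> {in Z, forall k, dot (phi k) u = 0} ->
  u = 0.
Proof.
move=> spark /card_geqP [s [s_uniq s_size s_sub]] uZ; apply: dot_eq0.
have cardK : #|[set k in s]| = d by rewrite cardsE (card_uniqP s_uniq).
have /andP [/eqP spanK _] := spark _ cardK.
have : u \in <<[seq phi j | j in [set k in s]]>>%VS by rewrite spanK memvf.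
move=> /coord_span {2}->; rewrite dot_sumr big1 // => i _; rewrite dotZr.
have lt_i : (i < size [seq phi j | j in [set k in s]])%N by rewrite size_image.
have /imageP [k] := mem_nth 0 lt_i.
by rewrite inE => /s_sub kZ ->; rewrite dotC uZ ?mulr0.
Qed.

(** The support of the relation lies in a set of exactly [d] indices, over which
    the vectors are independent. *)
Lemma full_spark_relation_eq0 (R : realType) (n d : nat)
    (phi : 'I_n -> 'rV[R]_d) (T : {set 'I_n}) (x : 'I_n -> R) :
  full_spark phi -> (d <= n)%N -> (#|T| <= d)%N ->
  (forall k, k \notin T -> x k = 0) -> \sum_k x k *: phi k = 0 ->
  forall k, x k = 0.
Proof.
move=> spark le_dn le_Td xT sum0 k.
have [K TK cardK] : exists2 K : {set 'I_n}, T \subset K & #|K| = d.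
  have : (d - #|T| <= #|~: T|)%N by rewrite [#|~: T|]cardsCs setCK card_ord leq_sub2r.
  move=> /card_geqP [s [s_uniq s_size s_sub]].
  exists (T :|: [set k in s]); first exact: subsetUl.
  rewrite cardsU disjoint_setI0 ?cards0 ?subn0.
    by rewrite cardsE (card_uniqP s_uniq) s_size subnKC.
  by rewrite disjoint_sym disjoints_subset; apply/subsetP => j /[!inE] /s_sub /[!inE].
have [kK|kK] := boolP (k \in K); last first.
  by apply: xT; apply: contra kK; apply/subsetP.
have /andP [_ freeK] := spark _ cardK.
have /freeP xK0 : free (image_tuple phi K) by [].
rewrite -(enum_rankK_in kK kK).
apply: (xK0 (fun i => x (enum_val i))) => //.
rewrite -[RHS]sum0 [RHS](bigID (fun j => j \in K)) /= [X in _ + X]big1 => [|j jK].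
  by rewrite addr0 [RHS]big_enum_val; apply: eq_bigr => i _; rewrite nth_image.
by rewrite xT ?scale0r //; apply: contra jK; apply/subsetP.
Qed.

(** * Tight frames *)

Lemma tight_frame_dot (R : realType) (n d : nat) (phi : 'I_n -> 'rV[R]_d)
    (a : R) (y z : 'rV[R]_d) :
  (forall y, \sum_(k < n) dot (phi k) y *: phi k = a *: y) ->
  \sum_(k < n) dot (phi k) y * dot (phi k) z = a * dot y z.
Proof.
move=> frame; rewrite (dotC y) -dotZr -frame dot_sumr; apply: eq_bigr => k _.
by rewrite dotZr (dotC z).
Qed.

(** Each standard basis vector is recovered from its frame expansion, so each
    coordinate contributes [a] to the sum. *)
Lemma tight_frame_trace (R : realType) (n d : nat) (phi : 'I_n -> 'rV[R]_d)
    (a : R) :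
  (forall y, \sum_(k < n) dot (phi k) y *: phi k = a *: y) ->
  \sum_(k < n) dot (phi k) (phi k) = a * d%:R.
Proof.
move=> frame; rewrite exchange_big /=.
rewrite (eq_bigr (fun=> a)) => [|m _]; first by rewrite sumr_const card_ord mulr_natr.
have dot_delta k : dot (phi k) (delta_mx 0 m) = phi k 0 m.
  rewrite /dot (bigD1 m) //= big1 => [|l /negPf ne]; rewrite mxE eqxx.
    by rewrite eqxx mulr1 addr0.
  by rewrite ne mulr0.
have /rowP/(_ m) := frame (delta_mx 0 m).
rewrite summxE !mxE !eqxx mulr1 => <-; apply: eq_bigr => k _.
by rewrite mxE dot_delta.
Qed.

(** * Pairs of vectors in an equiangular tight frame *)

(** When all these inner products have the same modulus, [s] is a sign and
    [k] differs from [i] and [j], exclusion from this set means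
    [<phi k, phi i> = - s <phi k, phi j>]. *)
Definition agree (R : realType) (n d : nat) (phi : 'I_n -> 'rV[R]_d)
    (s : R) (i j : 'I_n) : {set 'I_n} :=
  [set k | [&& k != i, k != j & dot (phi k) (phi i) == s * dot (phi k) (phi j)]].

Section ETFPairs.

Variables (R : realType) (n d : nat) (phi : 'I_n -> 'rV[R]_d) (g c a : R).
Hypothesis norm_g : forall j, dot (phi j) (phi j) = g.
Hypothesis angle_c : forall j j', j != j' -> `|dot (phi j) (phi j')| = c.
Hypothesis frame_a :
  forall y, \sum_(k < n) dot (phi k) y *: phi k = a *: y.

Lemma dot_opposite (s : R) (i j k : 'I_n) :
  s ^+ 2 = 1 -> k != i -> k != j -> k \notin agree phi s i j ->
  dot (phi k) (phi i) = - (s * dot (phi k) (phi j)).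
Proof.
move=> s2 ki kj; rewrite inE ki kj /= => neq.
have : dot (phi k) (phi i) ^+ 2 == (s * dot (phi k) (phi j)) ^+ 2.
  by rewrite exprMn s2 mul1r -!(real_normK (num_real (dot _ _))) !angle_c.
by rewrite eqf_sqr (negPf neq) => /eqP.
Qed.

Lemma frame_norm (i : 'I_n) : a * g = g ^+ 2 + (n.-1)%:R * c ^+ 2.
Proof.
rewrite -(norm_g i) -(tight_frame_dot _ _ frame_a) (bigD1 i) //= norm_g expr2.
congr (_ + _); rewrite (eq_bigr (fun=> c ^+ 2)) => [|k ki].
  rewrite sumr_const mulr_natl; congr (_ *+ _).
  by have := cardC1 i; rewrite card_ord => <-; apply: eq_card => k.
by rewrite -expr2 -(real_normK (num_real (dot _ _))) angle_c.
Qed.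

(** In the frame expansion of [<phi i, phi j>] each [k] in [agree] contributes
    [s c^2], each other [k] distinct from [i] and [j] contributes [- s c^2], and
    [i] and [j] contribute [g s c] each. *)
Lemma card_agree (s : R) (i j : 'I_n) :
  i != j -> s ^+ 2 = 1 -> dot (phi i) (phi j) = s * c -> c != 0 ->
  a - 2 * g = c * (2 * #|agree phi s i j|%:R - (n%:R - 2)).
Proof.
move=> ij s2 gij c0.
have s0 : s != 0 by apply: contra_eq_neq s2 => ->; rewrite expr0n eq_sym oner_eq0.
have gji : dot (phi j) (phi i) = s * c by rewrite dotC.
pose Z := agree phi s i j.
have : \sum_(k < n) dot (phi k) (phi i) * dot (phi k) (phi j)
     = \sum_(k < n) (s * c ^+ 2 * (2 * (k \in Z)%:R - 1)
         + (if k == i then s * c ^+ 2 + g * s * c else 0)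
         + (if k == j then s * c ^+ 2 + g * s * c else 0)).
  (* The value - s c^2 that the main term takes at i and j is corrected by the
     two conditional terms. *)
  apply: eq_bigr => k _.
  have [->|ki] := eqVneq k i; first by rewrite (negPf ij) /Z inE eqxx /= norm_g gij; ring.
  have [->|kj] := eqVneq k j; first by rewrite /Z inE eqxx andbF /= norm_g gji; ring.
  have sq : dot (phi k) (phi j) ^+ 2 = c ^+ 2.
    by rewrite -(real_normK (num_real (dot _ _))) angle_c.
  have [kZ|kZ] := boolP (k \in Z).
    have : dot (phi k) (phi i) = s * dot (phi k) (phi j).
      by apply/eqP; move: kZ; rewrite inE => /and3P [].
    by move=> ->; rewrite -sq /=; ring.
  by rewrite (dot_opposite s2 ki kj kZ) -sq /=; ring.
rewrite (tight_frame_dot _ _ frame_a) gij !big_split /= -!big_mkcond !big_pred1_eq.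
rewrite -mulr_sumr sumrB -mulr_sumr sumr_const card_ord.
rewrite -natr_sum -big_mkcond sum1_card.
set z := #|_|%:R => eq; apply: (mulfI (mulf_neq0 s0 c0)).
have -> : s * c * (a - 2 * g) = a * (s * c) - 2 * g * (s * c) by ring.
by rewrite eq; ring.
Qed.

(** The set indexes vectors orthogonal to [phi i - s phi j], which is nonzero
    because two of the vectors are independent. *)
Lemma card_agree_lt (s : R) (i j : 'I_n) :
  full_spark phi -> (1 < d)%N -> (d <= n)%N -> i != j ->
  (#|agree phi s i j| < d)%N.
Proof.
move=> spark d_gt1 le_dn ij; have ji : j != i by rewrite eq_sym.
rewrite ltnNge; apply/negP => le_dZ.
have u0 : phi i + (- s) *: phi j = 0.
  apply: (full_spark_orthogonal_eq0 spark le_dZ) => k.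
  by rewrite inE dotDr dotZr => /and3P [_ _ /eqP ->]; ring.
have le_T : (#|[set i; j]| <= d)%N by rewrite cards2 ij.
pose x k : R := (k == i)%:R - s * (k == j)%:R.
have /(_ i) /eqP : forall k, x k = 0.
  apply: (full_spark_relation_eq0 spark le_dn le_T) => [k|]; rewrite /x.
  - by rewrite !inE negb_or => /andP [/negPf -> /negPf ->]; rewrite mulr0 subr0.
  - rewrite -[RHS]u0 (bigD1 i) //= (bigD1 j) //= big1 => [|k /andP [ki kj]].
      by rewrite !eqxx (negPf ij) (negPf ji) mulr0 mulr1 subr0 scale1r sub0r addr0.
    by rewrite (negPf ki) (negPf kj) mulr0 subr0 scale0r.
by rewrite /x eqxx (negPf ij) mulr0 subr0 oner_eq0.
Qed.

(** The relation is [\sum_k <phi k, v> phi k - a v = 0] for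
    [v = phi i + s phi j]. For [k] distinct from [i] and [j] and outside [agree],
    the two terms of [<phi k, v>] cancel; the coefficient of [phi i] is
    [g + c - a]. *)
Lemma card_agree_ge (s : R) (i j : 'I_n) :
  full_spark phi -> (d <= n)%N -> i != j -> s ^+ 2 = 1 ->
  dot (phi i) (phi j) = s * c -> g + c != a ->
  (d <= #|agree phi s i j|.+1)%N.
Proof.
move=> spark le_dn ij s2 gij ne_a; have ji : j != i by rewrite eq_sym.
rewrite leqNgt; apply/negP => lt_Zd.
have le_Td : (#|i |: (j |: agree phi s i j)| <= d)%N.
  rewrite !cardsU1 (leq_trans _ lt_Zd) // -[_.+2]/(1 + (1 + _))%N.
  by rewrite !leq_add ?leq_b1.
pose x k := dot (phi k) (phi i + s *: phi j) - a * ((k == i)%:R + s * (k == j)%:R).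
have /(_ i) /eqP : forall k, x k = 0.
  apply: (full_spark_relation_eq0 spark le_dn le_Td) => [k|]; rewrite /x.
  - rewrite !in_setU1 !negb_or => /and3P [ki kj kZ].
    rewrite dotDr dotZr (dot_opposite s2 ki kj kZ) (negPf ki) (negPf kj).
    by rewrite addNr mulr0 addr0 mulr0 subr0.
  - under eq_bigr do rewrite scalerBl.
    rewrite sumrB frame_a -[RHS](subrr (a *: (phi i + s *: phi j))); congr (_ - _).
    rewrite (bigD1 i) //= (bigD1 j) //= big1 => [|k /andP [ki kj]].
      rewrite !eqxx (negPf ij) (negPf ji) mulr0 mulr1 addr0 mulr1 add0r addr0.
      by rewrite scalerDr scalerA.
    by rewrite (negPf ki) (negPf kj) mulr0 addr0 mulr0 scale0r.
rewrite /x eqxx (negPf ij) dotDr dotZr norm_g gij mulrA -expr2 s2.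
by rewrite mulr0 addr0 mul1r mulr1 subr_eq0 (negPf ne_a).
Qed.

End ETFPairs.
Unset Implicit Arguments.

Theorem theorem3p2 (R : realType) (n d : nat) (phi : 'I_n -> 'rV[R]_d)
    (hd1 : (1 < d)%N) (hdn : (d < n - 1)%N)
    (hetf : ETF phi) (hspark : full_spark phi) :
  n = (2 * d)%N.
Proof.
case: hetf => phi0 [r norm_r] [c angle_c] [a _ frame_a].
case: n phi hdn hspark phi0 norm_r angle_c frame_a => // n1 phi hdn hspark phi0
  norm_r angle_c frame_a.
rewrite subn1 /= in hdn.
pose g := r ^+ 2.
have norm_g j : dot (phi j) (phi j) = g by rewrite /g -(norm_r j) sqr_sqrtr ?dot_ge0.
pose i : 'I_n1.+1 := ord0; pose j : 'I_n1.+1 := ord_max.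
have ij : i != j by rewrite -val_eqE /= eq_sym -lt0n; apply: leq_trans hdn.
have g_gt0 : 0 < g.
  rewrite lt_neqAle -{2}(norm_g i) dot_ge0 andbT eq_sym.
  by apply: contra (phi0 i) => /eqP g0; apply/eqP/dot_eq0; rewrite norm_g.
have c_ge0 : 0 <= c by rewrite -(angle_c _ _ ij).
have d_gt0 : 0 < d%:R :> R by rewrite ltr0n; apply: leq_trans hd1.
have trace : a * d%:R = n1.+1%:R * g.
  rewrite -(tight_frame_trace frame_a) (eq_bigr (fun=> g)) => [|k _] //.
  by rewrite sumr_const card_ord mulr_natl.
have norms := frame_norm norm_g angle_c frame_a i; rewrite /= in norms.
have le_dn : (d <= n1.+1)%N by apply/ltnW/ltnW.
(* If c = 0 then a = g, and the trace identity forces d = n. *)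
have c_neq0 : c != 0.
  apply/eqP => c0; rewrite c0 expr0n mulr0 addr0 expr2 in norms.
  move: trace; rewrite (mulIf (lt0r_neq0 g_gt0) norms) mulrC.
  move=> /(mulIf (lt0r_neq0 g_gt0)) /eqP; rewrite eqr_nat => /eqP d_eq.
  by rewrite d_eq ltnNge leqnSn in hdn.
(* If a = g + c then g = (n - 1) c, and the trace identity forces d = n - 1. *)
have ne_a : g + c != a.
  apply/eqP => a_eq.
  have g_eq : g = n1%:R * c.
    apply: (mulIf c_neq0); apply: (addrI (g ^+ 2)).
    have -> : g ^+ 2 + g * c = (g + c) * g by ring.
    by rewrite a_eq norms; ring.
  have /eqP : c * n1.+1%:R * d%:R = c * n1.+1%:R * n1%:R.
    have -> : c * n1.+1%:R = a by rewrite -a_eq g_eq -natr1; ring.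
    by rewrite trace -a_eq g_eq -natr1; ring.
  rewrite (inj_eq (mulfI _)) ?mulf_neq0 ?pnatr_eq0 // eqr_nat => /eqP d_eq.
  by rewrite d_eq ltnn in hdn.
pose s : R := (-1) ^+ (dot (phi i) (phi j) < 0)%R.
have s2 : s ^+ 2 = 1 by rewrite sqrr_sign.
have gij : dot (phi i) (phi j) = s * c by rewrite -(angle_c _ _ ij) -numEsign.
have card_Z : #|agree phi s i j|.+1 = d.
  apply/eqP; rewrite eqn_leq card_agree_lt //=.
  exact: card_agree_ge norm_g angle_c frame_a _ _ _ hspark _ _ _ _ _.
have := card_agree norm_g angle_c frame_a ij s2 gij c_neq0.
have -> : #|agree phi s i j|%:R = d%:R - 1 :> R by apply: (addIr 1); rewrite subrK natr1 card_Z.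
move=> count.
have /eqP : (n1.+1%:R - 2 * d%:R) * (g + c * d%:R) = 0.
  have -> : (n1.+1%:R - 2 * d%:R) * (g + c * d%:R)
     = n1.+1%:R * g - 2 * g * d%:R - c * (2 * (d%:R - 1) - (n1.+1%:R - 2)) * d%:R by ring.
  by rewrite -trace -count; ring.
have : 0 < g + c * d%:R by rewrite ltr_wpDr // mulr_ge0.
rewrite mulf_eq0 => /gt_eqF ->.
by rewrite orbF -natrM subr_eq0 eqr_nat => /eqP.
Qed.
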